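(* Let $A$ be any algebra. A collection of recognizable subsets of $A$ is a sublattice of $\mathrm{Rec}(A)$ if and only if it can be defined by a set of profinite lattice equations for $A$; that is, if and only if there is a set $\Sigma\subseteq\widehat A\times\widehat A$ such that the collection consists exactly of those $L\in\mathrm{Rec}(A)$ that satisfy $x\to y$ for every $(x,y)\in\Sigma$.
   Context: $A$ is an algebra of some (finitary) type $\tau$. All lattices are bounded, so a sublattice of $\mathrm{Rec}(A)$ is a subset containing $\emptyset$ and $A$ and closed under binary union and intersection. A subset $L\subseteq A$ is recognizable if $L=\varphi^{-1}(P)$ for some homomorphism $\varphi:A\to F$ into a finite algebra $F$ of type $\tau$ and some $P\subseteq F$; $\mathrm{Rec}(A)$ is the Boolean algebra of recognizable subsets. The profinite completion $\widehat{A}$ is the inverse limit, as a topological algebra, of the finite discrete algebras $A/\theta$, $\theta$ ranging over the congruences of $A$ of finite index. A point $x=(x_\theta)_\theta\in\widehat A$ is identified with the prime filter $F_x$ of $\mathrm{Rec}(A)$ such that, for $L=q_\theta^{-1}(P)$ with $q_\theta:A\to A/\theta$ the quotient map and $P\subseteq A/\theta$, $L\in F_x\iff x_\theta\in P$. A profinite lattice equation for $A$ is a pair $x,y\in\widehat A$, written $x\to y$; it is satisfied by $L\in\mathrm{Rec}(A)$ iff $L\in F_y$ implies $L\in F_x$. *)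

(* Defs.v *)
From HB Require Import structures.
From mathcomp Require Import all_boot all_order all_algebra.
From mathcomp Require Import all_classical topology.

Set Implicit Arguments.
Unset Strict Implicit.
Unset Printing Implicit Defensive.

Local Open Scope classical_set_scope.

Record signature := Signature {
  symbol :> Type;
  arity : symbol -> nat
}.

(* The carrier may be empty. *)
Record algebra (tau : signature) := Algebra {
  carrier :> Type;
  oper : forall f : tau, ('I_(arity f) -> carrier) -> carrier
}.

Section Recognizable.
Variable tau : signature.
Implicit Types A F : algebra tau.

Definition homomorphism A F (phi : A -> F) : Prop :=
  forall (f : tau) (u : 'I_(arity f) -> A),
    phi (oper u) = oper (fun i => phi (u i)).

Definition finite_algebra F : Prop := finite_set [set: F].

Definition recognizable A (L : set A) : Prop :=
  exists (F : algebra tau) (phi : A -> F) (P : set F),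
    [/\ finite_algebra F, homomorphism phi & L = phi @^-1` P].

End Recognizable.

Definition Rec (tau : signature) (A : algebra tau) : set (set A) :=
  [set L | recognizable L].
Arguments Rec {tau} A.

Definition sublattice_Rec (tau : signature) (A : algebra tau) (K : set (set A)) : Prop :=
  [/\ K `<=` Rec A, K set0, K setT, setU_closed K & setI_closed K].

Section Congruences.
Variables (tau : signature) (A : algebra tau).

Record congruence := Congruence {
  cong :> A -> A -> Prop;
  cong_refl : forall a, cong a a;
  cong_sym : forall a b, cong a b -> cong b a;
  cong_trans : forall a b c, cong a b -> cong b c -> cong a c;
  cong_oper : forall (f : tau) (u v : 'I_(arity f) -> A),
    (forall i, cong (u i) (v i)) -> cong (oper u) (oper v)
}.

Implicit Types theta : congruence.

(* The elements of A/theta are the classes [set b | theta a b] = theta a. *)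
Definition quotient theta : Type :=
  discrete_topology (set_type (range (theta : A -> set A))).

HB.instance Definition _ theta := DiscreteTopology.on (quotient theta).

Definition class theta (a : A) : quotient theta :=
  SigSub (mem_set (imageT (theta : A -> set A) a)).

Lemma class_surj theta (c : quotient theta) : exists a, class theta a = c.
Proof. by have [a _ ac] := set_mem (valP c); exists a; exact: val_inj. Qed.

Lemma classE theta a b : class theta a = class theta b <-> theta a b.
Proof.
split=> [/(congr1 val)/= ab|ab].
  suff: (theta b : set A) b by rewrite -ab.
  exact: cong_refl.
apply: val_inj; apply/seteqP; split=> c /=.
  exact/cong_trans/cong_sym.
exact: cong_trans.
Qed.

Definition repr theta (c : quotient theta) : A := sval (cid (class_surj c)).

Lemma reprK theta (c : quotient theta) : class theta (repr c) = c.
Proof. exact: (svalP (cid (class_surj c))). Qed.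

(* The algebra A/theta; class_hom shows that its operations do not depend on
   the representatives. *)
Definition quotient_algebra theta : algebra tau :=
  @Algebra tau (quotient theta)
    (fun f u => class theta (oper (fun i => repr (u i)))).

Lemma class_hom theta : @homomorphism tau A (quotient_algebra theta) (class theta).
Proof.
by move=> f u; apply/classE/cong_oper => i; apply/classE; rewrite reprK.
Qed.

(* The canonical map A/theta -> A/theta', meaningful when theta is contained
   in theta'. *)
Definition quotient_map theta theta' (c : quotient theta) : quotient theta' :=
  class theta' (repr c).

Lemma quotient_map_class theta theta' a :
  (forall b c, theta b c -> theta' b c) ->
  quotient_map theta' (class theta a) = class theta' a.
Proof. by move=> sub; apply/classE/sub/classE; rewrite reprK. Qed.

Definition finite_index theta : Prop := finite_algebra (quotient_algebra theta).

End Congruences.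

Section ProfiniteCompletion.
Variables (tau : signature) (A : algebra tau).

Definition fi_congruence : Type := {theta : congruence A | finite_index theta}.

Definition compatible
    (x : forall theta : fi_congruence, quotient (sval theta)) : Prop :=
  forall theta theta' : fi_congruence,
    (forall a b, sval theta a b -> sval theta' a b) ->
    quotient_map (sval theta') (x theta) = x theta'.

(* The inverse limit of the A/theta, with the topology induced by the product
   of the discrete topologies. *)
Definition completion : Type :=
  set_type [set x : prod_topology (fun theta : fi_congruence =>
                                     quotient (sval theta)) | compatible x].

HB.instance Definition _ := Topological.on completion.

Definition coordinate (x : completion) (theta : fi_congruence) :
  quotient (sval theta) := set_val x theta.

Lemma completion_oper_compatible (f : tau) (u : 'I_(arity f) -> completion) :
  compatible (fun theta => @oper tau (quotient_algebra (sval theta)) f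
                             (fun i => coordinate (u i) theta)).
Proof.
move=> theta theta' sub; rewrite [LHS]quotient_map_class//.
rewrite class_hom; congr (@oper tau (quotient_algebra _) f _).
by apply/funext => i; exact: (set_mem (valP (u i)) theta theta' sub).
Qed.

Definition completion_algebra : algebra tau :=
  @Algebra tau completion
    (fun f u => SigSub (mem_set (completion_oper_compatible u
      : [set x : prod_topology _ | compatible x] _))).

Lemma coordinate_continuous (theta : fi_congruence) :
  continuous (fun x : completion => coordinate x theta).
Proof.
pose Q (t : fi_congruence) := quotient (sval t).
move=> x; apply: (@continuous_comp _ _ _
  (set_val : completion -> prod_topology Q) (@proj _ Q theta)).
  exact: initial_continuous.
exact: (@proj_continuous {classic fi_congruence} Q theta).
Qed.

Lemma completion_oper_continuous (f : tau) :
  continuous (@oper tau completion_algebra f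
    : prod_topology (fun _ : 'I_(arity f) => completion) -> completion).
Proof.
pose X := prod_topology (fun _ : 'I_(arity f) => completion).
apply: continuous_comp_initial => u.
apply/cvg_sup; first exact/fmap_filter/nbhs_filter.
move=> theta U [_ [[W oW <-] /= Wu]] /filterS; apply.
  exact/fmap_filter/nbhs_filter.
pose agree i : set X :=
  [set v | coordinate (v i) theta = coordinate (u i) theta].
have agree_u : nbhs (u : X) [set v | forall i, agree i v].
  apply: (filter_forall (nbhs_filter (u : X))) => i.
  have pc := @proj_continuous 'I_(arity f) (fun=> completion) i (u : X).
  have cc := continuous_comp pc (@coordinate_continuous theta (u i)).
  have := cc [set coordinate (u i) theta]; rewrite /= /nbhs/=; apply.
  exact: (@discrete_set1 (quotient (sval theta)) (coordinate (u i) theta)).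
apply: (@filterS _ _ (nbhs_filter (u : X)) _ _ _ agree_u) => v vu.
rewrite /preimage/=.
suff -> : set_val (@oper tau completion_algebra f v) theta =
   set_val (@oper tau completion_algebra f u) theta by [].
rewrite /=; congr (@oper tau (quotient_algebra _) f _).
by apply/funext => i; exact: vu.
Qed.

(* The prime filter F_x; by filter_ofE, membership of L in F_x does not depend
   on the representation of L as the inverse image of a subset of a finite
   quotient. *)
Definition filter_of (x : completion) : set (set A) :=
  [set L | exists (theta : fi_congruence) (P : set (quotient (sval theta))),
     L = class (sval theta) @^-1` P /\ P (coordinate x theta)].

Lemma coordinate_common (x : completion) (theta theta' : fi_congruence) :
  exists a, coordinate x theta = class (sval theta) a /\
            coordinate x theta' = class (sval theta') a.
Proof.
have xc : compatible (coordinate x) by exact: (set_mem (valP x)).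
pose r := sval theta; pose r' := sval theta'.
have meet_oper (f : tau) (u v : 'I_(arity f) -> A) :
    (forall i, r (u i) (v i) /\ r' (u i) (v i)) ->
    r (oper u) (oper v) /\ r' (oper u) (oper v).
  by move=> uv; split; apply: cong_oper => i; case: (uv i).
pose m : congruence A := @Congruence tau A (fun a b => r a b /\ r' a b)
  (fun a => conj (cong_refl r a) (cong_refl r' a))
  (fun a b ab => conj (cong_sym ab.1) (cong_sym ab.2))
  (fun a b c ab bc => conj (cong_trans ab.1 bc.1) (cong_trans ab.2 bc.2))
  meet_oper.
have mfin : finite_index m.
  pose g (c : quotient m) := (quotient_map r c, quotient_map r' c).
  have gI : {in [set: quotient m] &, injective g}.
    move=> c d _ _ gcd.
    have /classE rcd : quotient_map r c = quotient_map r d := congr1 fst gcd.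
    have /classE r'cd : quotient_map r' c = quotient_map r' d :=
      congr1 snd gcd.
    by rewrite -(reprK c) -(reprK d); apply/classE; split.
  suff : finite_set (g @` setT) by rewrite (eq_finite_set (inj_card_eq gI)).
  by apply: sub_finite_set (finite_setX (svalP theta) (svalP theta')).
pose t : fi_congruence := exist _ m mfin.
exists (repr (coordinate x t)); split.
- by rewrite -(xc t theta)// => a b [].
- by rewrite -(xc t theta')// => a b [].
Qed.

Lemma filter_ofE (x : completion) (theta : fi_congruence)
    (P : set (quotient (sval theta))) :
  filter_of x (class (sval theta) @^-1` P) <-> P (coordinate x theta).
Proof.
split=> [[theta' [P' [PP' P'x]]]|Px]; last by exists theta, P.
have [a [xa xa']] := coordinate_common x theta theta'.
suff : (class (sval theta) @^-1` P) a by rewrite /preimage/= -xa.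
by rewrite PP' /preimage /= -xa'.
Qed.

Definition lattice_equation : Type := (completion * completion)%type.

(* The pair (x, y) stands for the equation x -> y. *)
Definition satisfies (L : set A) (e : lattice_equation) : Prop :=
  filter_of e.2 L -> filter_of e.1 L.

Definition defined_by (Sigma : set lattice_equation) : set (set A) :=
  [set L | Rec A L /\ forall e, Sigma e -> satisfies L e].

End ProfiniteCompletion.

(* Main.v *)
Require Import Defs.
From mathcomp Require Import all_boot finmap all_classical topology.

(** Every ultrafilter [V] on the set [A] determines a point of the profinite
    completion: for each congruence [theta] of finite index exactly one of the
    finitely many [theta]-classes belongs to [V], and these classes are
    compatible because any two members of [V] meet.  The prime filter of this
    point is the trace of [V] on the recognizable sets
    ([completion_of_ultrafilter]), so points of the completion can be produced
    by the ultrafilter lemma.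

    A sublattice [K] is defined by the set of all equations that its members
    satisfy.  What has to be shown is that a recognizable [L] outside
    [K] violates one of them.  No member of [K] contained in [L] is all of [L],
    and such members are closed under union, so the sets [L `\` M] with [M] in
    [K] and [M] contained in [L] generate a proper filter; let [V] be an
    ultrafilter above it.  A member [M] of [K] that belongs to [V] cannot be
    contained in [L], so the sets [M `\` L] with [M] in [K] and in [V] generate
    again a proper filter; let [U] be an ultrafilter above it.  Every member of
    [K] in [V] is in [U], while [L] is in [V] but not in [U]
    ([separating_ultrafilters]): the equation from the point of [U] to the
    point of [V] holds throughout [K] and fails for [L].

    That the sets satisfying given equations form a sublattice holds because
    each [filter_of x] is a prime filter of the lattice of recognizable sets;
    for binary operations this is read off a single finite quotient recognizing
    both arguments ([Rec_common_congruence]). *)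

Set Implicit Arguments.
Unset Strict Implicit.
Unset Printing Implicit Defensive.

Local Open Scope classical_set_scope.

(** * Recognition by congruences of finite index *)

Section RecognizableLattice.
Variables (tau : signature) (A : algebra tau).
Implicit Types (L M : set A) (x : completion A).

(** The congruence is the kernel of [phi], whose classes inject into [F]. *)
Lemma kernel_congruence (F : algebra tau) (phi : A -> F) :
  finite_algebra F -> homomorphism phi ->
  exists theta : fi_congruence A, forall P : set F,
    exists Q : set (quotient (sval theta)),
      phi @^-1` P = class (sval theta) @^-1` Q.
Proof.
move=> finF hom.
have kop (f : tau) (u v : 'I_(arity f) -> A) :
    (forall i, phi (u i) = phi (v i)) -> phi (oper u) = phi (oper v).
  by move=> uv; rewrite !hom; congr oper; apply/funext.
pose k : congruence A := @Congruence tau A (fun a b => phi a = phi b)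
  (fun a => erefl) (fun a b e => esym e) (fun a b c => @etrans _ _ _ _) kop.
have phi_repr a : phi (Defs.repr (class k a)) = phi a.
  by have /classE : class k (Defs.repr (class k a)) = class k a
    by rewrite Defs.reprK.
have kfin : finite_index k.
  pose g (c : quotient k) := phi (Defs.repr c).
  have gI : {in [set: quotient k] &, injective g}.
    move=> c d _ _ gcd.
    by rewrite -(Defs.reprK c) -(Defs.reprK d); apply/classE.
  have : finite_set (g @` setT) by apply: sub_finite_set finF.
  by rewrite (eq_finite_set (inj_card_eq gI)).
exists (exist _ k kfin) => P; exists [set c | P (phi (Defs.repr c))].
by apply/seteqP; split=> a; rewrite /preimage/= phi_repr.
Qed.

Lemma Rec_class (theta : fi_congruence A) (Q : set (quotient (sval theta))) :
  Rec A (class (sval theta) @^-1` Q).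
Proof.
exists (quotient_algebra (sval theta)), (class (sval theta)), Q.
by split; [exact: (svalP theta)|exact: class_hom|].
Qed.

(** The product of two algebras recognizing [L] and [M] recognizes both. *)
Lemma Rec_common_congruence L M : Rec A L -> Rec A M ->
  exists (theta : fi_congruence A) (P Q : set (quotient (sval theta))),
    L = class (sval theta) @^-1` P /\ M = class (sval theta) @^-1` Q.
Proof.
move=> [F [phi [P [finF homF ->]]]] [G [psi [Q [finG homG ->]]]].
pose FG : algebra tau := @Algebra tau (F * G)%type
  (fun f u => (oper (fun i => (u i).1), oper (fun i => (u i).2))).
have finFG : finite_algebra FG.
  by apply: sub_finite_set (finite_setX finF finG).
have homFG : @homomorphism tau A FG (fun a => (phi a, psi a)).
  by move=> f u; rewrite homF homG.
have [theta H] := kernel_congruence finFG homFG.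
have [P' PE] := H (fst @^-1` P).
have [Q' QE] := H (snd @^-1` Q).
by exists theta, P', Q'.
Qed.

(** Constant predicates, rather than [set0] and [setT], treat both bounds of the
    lattice at once; they are recognized by the one-element algebra. *)
Lemma Rec_const (p : Prop) : Rec A [set _ | p].
Proof.
exists (@Algebra tau unit (fun _ _ => tt)), (fun _ => tt), [set _ | p].
by split=> //; exact: finite_finset.
Qed.

Lemma RecU L M : Rec A L -> Rec A M -> Rec A (L `|` M).
Proof.
move=> RL RM; have [theta [P [Q [-> ->]]]] := Rec_common_congruence RL RM.
by rewrite -preimage_setU; exact: Rec_class.
Qed.

Lemma RecI L M : Rec A L -> Rec A M -> Rec A (L `&` M).
Proof.
move=> RL RM; have [theta [P [Q [-> ->]]]] := Rec_common_congruence RL RM.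
by rewrite -preimage_setI; exact: Rec_class.
Qed.

(** The coordinates of [x] are classes of elements of [A], so a constant set
    that is the inverse image of [P] has the truth value of [P] at each of
    them. *)
Lemma filter_of_const x (p : Prop) : filter_of x [set _ | p] <-> p.
Proof.
have Rp := Rec_const p.
have [theta [P [_ [pE _]]]] := Rec_common_congruence Rp Rp.
rewrite pE filter_ofE -(Defs.reprK (coordinate x theta)).
by rewrite -[P _]/((class (sval theta) @^-1` P) _) -pE.
Qed.

Lemma filter_ofU x L M : Rec A L -> Rec A M ->
  filter_of x (L `|` M) <-> filter_of x L \/ filter_of x M.
Proof.
move=> RL RM; have [theta [P [Q [-> ->]]]] := Rec_common_congruence RL RM.
by rewrite -preimage_setU !filter_ofE.
Qed.

Lemma filter_ofI x L M : Rec A L -> Rec A M ->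
  filter_of x (L `&` M) <-> filter_of x L /\ filter_of x M.
Proof.
move=> RL RM; have [theta [P [Q [-> ->]]]] := Rec_common_congruence RL RM.
by rewrite -preimage_setI !filter_ofE.
Qed.

Lemma defined_by_sublattice (Sigma : set (lattice_equation A)) :
  sublattice_Rec (defined_by Sigma).
Proof.
split=> [L []//|||L M [RL SL] [RM SM]|L M [RL SL] [RM SM]].
- split=> [|e _]; first exact: (Rec_const False).
  by move=> /(filter_of_const _ False).
- split=> [|e _ _]; first exact: (Rec_const True).
  exact/(filter_of_const _ True).
- split=> [|e Se]; first exact: RecU.
  by rewrite /satisfies !filter_ofU// => -[/(SL _ Se)|/(SM _ Se)]; [left|right].
- split=> [|e Se]; first exact: RecI.
  by rewrite /satisfies !filter_ofI// => -[/(SL _ Se) ? /(SM _ Se) ?].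
Qed.

End RecognizableLattice.

(** * From ultrafilters to points of the completion *)

(** Otherwise the ultrafilter contains the complements of all the fibres, hence
    their finite intersection, which is empty. *)
Lemma ultra_finite_fiber (T S : Type) (V : set_system T) (h : T -> S) :
  UltraFilter V -> finite_set [set: S] -> exists c, V (h @^-1` [set c]).
Proof.
move=> UV finS; apply: contrapT => /forallNP noV.
have [X XE] := (@finite_fsetP {classic S} setT).1 finS.
have VN : V (\bigcap_(c in [set` X]) (h @^-1` [set~ c])).
  apply: filter_bigI => c _.
  by case: (in_ultra_setVsetC (h @^-1` [set c]) UV) => // /noV.
have [a /(_ (h a))] := filter_ex VN.
by rewrite -XE => /(_ I); apply.
Qed.

(** The coordinate at [theta] is the class that the ultrafilter contains.  A
    set of the ultrafilter meets that class, so a union of classes is in the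
    ultrafilter exactly when this class is one of them. *)
Lemma completion_of_ultrafilter (tau : signature) (A : algebra tau)
    (V : set_system A) : UltraFilter V ->
  exists x : completion A, forall L, Rec A L -> filter_of x L <-> V L.
Proof.
move=> UV.
have ex (theta : fi_congruence A) :
    {c | V (class (sval theta) @^-1` [set c])}.
  exact/cid/ultra_finite_fiber/(svalP theta).
pose x0 theta := sval (ex theta).
have Vx theta : V (class (sval theta) @^-1` [set x0 theta]) := svalP (ex theta).
have x0c : compatible x0.
  move=> theta theta' sub.
  have [a [/= <- <-]] := filter_ex (filterI (Vx theta) (Vx theta')).
  exact: quotient_map_class.
exists (SigSub (mem_set (x0c : [set x : prod_topology _ | compatible x] _))).
move=> L RL; have [theta [P [_ [-> _]]]] := Rec_common_congruence RL RL.
rewrite filter_ofE -[coordinate _ _]/(x0 theta); split=> [Px|VP].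
  by apply: filterS (Vx theta) => a; rewrite /preimage/= => ->.
by have [a [/= Pa <-]] := filter_ex (filterI VP (Vx theta)).
Qed.

(** * Separating a set from a lattice of sets *)

(** The ultrafilter [V] has to be chosen first, avoiding every member of [K]
    below [L]: this is what makes the members of [K] in [V] compatible with the
    complement of [L], so that [U] can contain them all and miss [L].  The empty
    and the full set in [K] ensure that [V] contains [L] and that [U] contains
    its complement. *)
Lemma separating_ultrafilters (T : Type) (K : set (set T)) (L : set T) :
  K set0 -> K setT -> setU_closed K -> setI_closed K -> ~ K L ->
  exists U V : set_system T,
    [/\ UltraFilter U, UltraFilter V, V L, ~ U L & K `&` V `<=` U].
Proof.
move=> K0 KT KU KI KL.
pose below := [set M | K M /\ M `<=` L].
have PF : ProperFilter (filter_from below (fun M => L `\` M)).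
  apply: filter_from_proper => [|M [KM ML]].
    apply: filter_from_filter => [|M N [KM ML] [KN NL]].
      by exists set0; split=> //; exact: sub0set.
    exists (M `|` N); first by split; [exact: KU|move=> a [/ML|/NL]].
    by rewrite setDUr.
  apply/set0P/eqP => LM0; have LM : L `<=` M by rewrite -setD_eq0.
  by apply: KL; rewrite (_ : L = M)//; apply/seteqP.
have [V [UV FV]] := ultraFilterLemma PF.
have V_below M : below M -> V (L `\` M) by move=> bM; apply: FV; exists M.
have PG : ProperFilter (filter_from (K `&` V) (fun M => M `\` L)).
  apply: filter_from_proper => [|M [KM VM]].
    apply: filter_from_filter => [|M N [KM VM] [KN VN]].
      by exists setT; split=> //; exact: filterT.
    exists (M `&` N); first by split; [exact: KI|exact: filterI].
    by move=> a [[Ma Na] nLa].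
  apply/set0P/eqP => ML0.
  have ML : M `<=` L by rewrite -setD_eq0.
  by have [a [Ma [_]]] := filter_ex (filterI VM (V_below M (conj KM ML))).
have [U [UU GU]] := ultraFilterLemma PG.
exists U, V; split=> //.
- by rewrite -[L]setD0; apply: V_below; split=> //; exact: sub0set.
- have UL : U (setT `\` L).
    by apply: GU; exists setT => //; split=> //; exact: filterT.
  by move=> /(filterI UL)/filter_ex[a [[_ nLa] /nLa]].
- by move=> M KVM; apply: GU; exists M => //; exact: subDsetl.
Qed.

Theorem corollary4p9 (tau : signature) (A : algebra tau) (K : set (set A))
    (K_Rec : K `<=` Rec A) :
  sublattice_Rec K <->
  exists Sigma : set (lattice_equation A), K = defined_by Sigma.
Proof.
split=> [[_ K0 KT KU KI]|[Sigma ->]]; last exact: defined_by_sublattice.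
exists [set e | forall M, K M -> satisfies M e].
apply/seteqP; split=> [M KM|L [RL SL]].
  by split=> [|e]; [exact: K_Rec|apply].
apply: contrapT => KL.
have [U [V [UU UV VL UL KVU]]] :=
  separating_ultrafilters K0 KT KU KI KL.
have [x xU] := completion_of_ultrafilter UU.
have [y yV] := completion_of_ultrafilter UV.
apply/UL/(xU L RL); apply: (SL (x, y)) => [M KM|]; last exact/yV.
by move/(yV M (K_Rec M KM)) => VM; apply/(xU M (K_Rec M KM))/KVU.
Qed.
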